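(* Let $\mathcal H_K$ be a reproducing kernel Hilbert space of complex-valued functions on a set $D$ with bounded kernel $K$, i.e. $R:=\sup_{x\in D}\sqrt{K(x,x)}<\infty$, and let $\mathcal K:=\{K(\cdot,x):x\in D\}\subset\mathcal H_K$. For every $m\in\mathbb N_0$, $$g_m(B_{\mathcal H_K})_\infty=g_m^{\mathrm{lin}}(B_{\mathcal H_K})_\infty=\tau_m(\mathcal K)_{\mathcal H_K}.$$
   Context: $B(D)$ is the space of bounded functions $D\to\mathbb C$ with norm $\|f\|_\infty=\sup_{x\in D}|f(x)|$. $\mathcal H_K$ is the reproducing kernel Hilbert space (RKHS) on $D$ with kernel $K\colon D\times D\to\mathbb C$, i.e. $f(x)=\langle f,K(\cdot,x)\rangle_{\mathcal H_K}$ for all $f\in\mathcal H_K$, $x\in D$. $B_{\mathcal H_K}$ is the unit ball of $\mathcal H_K$. Sampling widths: for $m\ge1$, $$g_m(B_{\mathcal H_K})_\infty:=\inf_{x_1,\dots,x_m\in D,\ \varphi}\ \sup_{f\in B_{\mathcal H_K}}\|f-\varphi(f(x_1),\dots,f(x_m))\|_\infty,$$ the infimum over all points and all (arbitrary, possibly non-linear) maps $\varphi\colon\mathbb C^m\to B(D)$. The linear sampling width $g_m^{\mathrm{lin}}(B_{\mathcal H_K})_\infty$ is defined in the same way but with $\varphi$ restricted to linear maps. For $m=0$ both are, by convention, $\sup_{f\in B_{\mathcal H_K}}\|f\|_\infty=R$. For finite $P\subset D$ let $V_P:=\mathrm{span}\{K(\cdot,x):x\in P\}$ (with $V_\varnothing=\{0\}$).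 Then $$\tau_m(\mathcal K)_{\mathcal H_K}:=\inf_{P\subset D,\ |P|\le m}\ \sup_{x\in D}\ \mathrm{dist}_{\mathcal H_K}\bigl(K(\cdot,x),V_P\bigr),$$ so $\tau_0(\mathcal K)_{\mathcal H_K}=R$. *)

(* Defs.v *)
From HB Require Import structures.
From mathcomp Require Import all_boot all_order all_algebra sesquilinear complex.
From mathcomp Require Import all_classical all_reals all_analysis.

Set Implicit Arguments.
Unset Strict Implicit.
Unset Printing Implicit Defensive.

Import Order.TTheory GRing.Theory Num.Theory Num.Def.
Import numFieldNormedType.Exports.

Local Open Scope classical_set_scope.
Local Open Scope card_scope.
Local Open Scope ring_scope.
Local Open Scope complex_scope.

(* Over R[i] the library norm `|v| is a nonnegative element of R[i];
   rnorm is the same number seen in R. *)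
Definition rnorm (R : realType) (V : normedZmodType R[i]) (v : V) : R :=
  complex.Re `|v|.

(* The elements of the Hilbert space are functions on D through rk_eval, which
   is linear and injective, i.e. the space is a linear subspace of D -> R[i]. *)
Record rkhs (R : realType) (D : Type) (K : D -> D -> R[i]) := RKHS {
  rk_space :> completeNormedModType R[i];
  rk_dot : {dot rk_space for conjC};
  rk_normE : forall f : rk_space, `|f| ^+ 2 = rk_dot f f;
  rk_eval : {linear rk_space -> (D -> R[i]^o)};
  rk_eval_inj : injective rk_eval;
  rk_kernel : D -> rk_space;
  rk_kernelE : forall x : D, rk_eval (rk_kernel x) = (fun y => K y x);
  rk_reproducing : forall (f : rk_space) (x : D),
    rk_eval f x = rk_dot f (rk_kernel x)
}.

Section Widths.
Variables (R : realType) (D : Type).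

Definition sup_norm (g : D -> R[i]^o) : \bar R :=
  ereal_sup [set (rnorm (g x))%:E | x in [set: D]].

Definition kernel_sup (K : D -> D -> R[i]) : \bar R :=
  ereal_sup [set (Num.sqrt (complex.Re (K x x)))%:E | x in [set: D]].

Variables (K : D -> D -> R[i]) (H : rkhs K).

Definition unit_ball : set H := [set f | rnorm f <= 1].

(* maps C^m -> B(D) *)
Definition recovery_maps (m : nat) : set ('rV[R[i]]_m -> (D -> R[i]^o)) :=
  [set phi | forall y, bounded_fun (phi y)].

Definition linear_recovery_maps (m : nat) :
    set ('rV[R[i]]_m -> (D -> R[i]^o)) :=
  [set phi | recovery_maps phi /\ linear phi].

Definition recovery_error (m : nat) (x : 'I_m -> D)
    (phi : 'rV[R[i]]_m -> (D -> R[i]^o)) : \bar R :=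
  ereal_sup [set sup_norm (rk_eval H f - phi (\row_i rk_eval H f (x i)))
            | f in unit_ball].

(* The case m = 0 is the usual convention for the initial error. *)
Definition sampling_width_over (m : nat)
    (Phi : set ('rV[R[i]]_m -> (D -> R[i]^o))) : \bar R :=
  if m is 0 then ereal_sup [set sup_norm (rk_eval H f) | f in unit_ball]
  else ereal_inf [set recovery_error p.1 p.2
                 | p in [set p : ('I_m -> D) * _ | Phi p.2]].

Definition sampling_width (m : nat) : \bar R :=
  sampling_width_over (@recovery_maps m).

Definition linear_sampling_width (m : nat) : \bar R :=
  sampling_width_over (@linear_recovery_maps m).

Definition lin_span (A : set H) : set H :=
  [set v | exists (n : nat) (a : 'I_n -> H) (c : 'I_n -> R[i]),
    (forall i, A (a i)) /\ v = \sum_(i < n) c i *: a i].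

Definition dist_to (V : set H) (u : H) : \bar R :=
  ereal_inf [set (rnorm (u - v))%:E | v in V].

(* P #<= `I_m says that P is finite with at most m elements. *)
Definition tau_width (m : nat) : \bar R :=
  ereal_inf
    [set ereal_sup [set dist_to (lin_span [set rk_kernel H x | x in P])
                                (rk_kernel H y)
                   | y in [set: D]]
    | P in [set P : set D | P #<= `I_m]].

End Widths.

(* Main.v *)
(* With r_y the residual of the orthogonal projection of K(.,y) onto
   V = span{K(.,x_i)}, one has dist(K(.,y), V) = |r_y|.  Writing the projection
   as sum_i c_i(y) K(.,x_i), the linear algorithm
   phi(a)(y) = sum_i conj(c_i(y)) a_i has error f(y) - phi(f(x))(y) = <f, r_y>,
   which is at most |r_y| on the unit ball.  Conversely f = r_y/|r_y| and -f both
   vanish at the nodes, so every algorithm returns the same phi(0) for them and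
   errs by at least f(y) = |r_y| at y on one of the two. *)
Require Import Defs.
From mathcomp Require Import all_boot all_order all_algebra sesquilinear complex.
From mathcomp Require Import lra.
From mathcomp Require Import all_classical all_reals all_analysis.

Import Order.TTheory GRing.Theory Num.Theory Num.Def.

Local Open Scope classical_set_scope.
Local Open Scope card_scope.
Local Open Scope ring_scope.
Local Open Scope complex_scope.

(** * Orthogonal projection onto finite spans *)

Section DotProduct.
Variables (C : numClosedFieldType) (U : lmodType C) (form : {dot U for conjC}).
Implicit Types u v w : U.

Local Notation "''[' u , v ]" := (form u%R v%R) : ring_scope.
Local Notation "''[' u ]" := '[u, u]%R : ring_scope.

Lemma dot_conj u v : '[u, v] = conjC '[v, u].
Proof. by rewrite (@hermC _ _ _ _ form) /= expr0 mul1r. Qed.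

Lemma dotZr u a v : '[u, a *: v] = conjC a * '[u, v].
Proof. by rewrite linearZr_LR. Qed.

Lemma dot_cauchy_schwarz u v : `|'[u, v]| <= sqrtC '[u] * sqrtC '[v].
Proof.
have [->|v0] := eqVneq v 0; first by rewrite !linear0r normr0 sqrtC0 mulr0.
have v_gt0 : 0 < '[v] by rewrite dnorm_gt0.
set a := '[u, v] / '[v]; set w := u - a *: v.
have ow : '[w, v] = 0.
  by rewrite linearBl /= linearZl_LR /= divfK ?subrr // gt_eqF.
have Eu : '[u] = '[w] + `|a| ^+ 2 * '[v].
  rewrite -{1 2}[u](subrK (a *: v)) -/w hnormDd /= ?dnormZ //.
  by rewrite /= dotZr ow mulr0.
rewrite -sqrtCM ?nnegrE // -[leLHS](sqrCK (normr_ge0 _)).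
rewrite ler_sqrtC ?nnegrE ?mulr_ge0 ?exprn_ge0 //.
rewrite Eu mulrDl -[leLHS]add0r lerD ?mulr_ge0 //.
rewrite /a normrM normfV (gtr0_norm v_gt0) exprMn -mulrA -mulrA -expr2.
by rewrite exprVn mulVf ?mulr1 // expf_neq0 // gt_eqF.
Qed.

(* Gram-Schmidt on coefficients: the residual [w] of the last vector [a n] is
   orthogonal to the previous ones, and [t u] is the coefficient of [u] along
   [w].  When [w = 0], [t u] is the junk value [0], which is the right one. *)
Lemma dot_projection_coef (a : nat -> U) (n : nat) :
  exists (c : U -> nat -> C) (M : nat -> C),
    (forall u i, (i < n)%N -> '[u - \sum_(j < n) c u j *: a j, a i] = 0) /\
    (forall j, 0 <= M j) /\ (forall u j, `|c u j| <= M j * sqrtC '[u]).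
Proof.
elim: n => [|n [c [M [co [M0 cM]]]]].
  by exists (fun _ _ => 0), (fun=> 0); split=> //; split=> // u j; rewrite normr0 mul0r.
pose r u := u - \sum_(j < n) c u j *: a j.
pose w := r (a n); pose t u := '[u, w] / '[w].
have rw u : '[r u, w] = '[u, w].
  rewrite linearBl /= -[RHS]subr0; congr (_ - _).
  rewrite dot_conj linear_sumr big1 ?conjC0 // => j _.
  by rewrite /= dotZr co ?mulr0.
(* The new residual is [r u - t u *: w]; expanding [w = a n - \sum_j c (a n) j *: a j] gives these
   coefficients. The bounds [M] follow from the triangle inequality and [tM]. *)
exists (fun u j => if j == n then t u else c u j - t u * c (a n) j).
exists (fun j => if j == n then (sqrtC '[w])^-1
                 else M j + (sqrtC '[w])^-1 * `|c (a n) j|).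
have tM u : `|t u| <= (sqrtC '[w])^-1 * sqrtC '[u].
  have [w0|w0] := eqVneq w 0.
    rewrite /t w0 linear0r mul0r normr0 mulr_ge0 ?invr_ge0 ?sqrt_dnorm_ge0 //.
  have s_gt0 : 0 < sqrtC '[w] by rewrite sqrt_dnorm_gt0.
  rewrite /t normrM normfV (ger0_norm (dnorm_ge0 form w)) -{1}(sqrtCK '[w]).
  rewrite ler_pdivrMr ?exprn_gt0 // expr2 mulrACA mulVf ?mul1r ?gt_eqF //.
  exact: dot_cauchy_schwarz.
split=> [u i|]; last split=> [j|u j]; last first.
- case: eqP => // _; rewrite mulrDl (le_trans (ler_normB _ _)) // lerD //.
  by rewrite normrM mulrAC ler_wpM2r.
- by case: eqP => _; rewrite ?addr_ge0 ?mulr_ge0 // invr_ge0 sqrt_dnorm_ge0.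
have -> : u - \sum_(j < n.+1) (if j == n :> nat then t u
              else c u j - t u * c (a n) j) *: a j = r u - t u *: w.
  rewrite big_ord_recr /= eqxx /w /r scalerBr opprB addrA scaler_sumr.
  rewrite opprD addrA; congr (_ - _); rewrite addrAC -addrA; congr (_ + _).
  rewrite -!sumrN -big_split /=; apply: eq_bigr => j _.
  by rewrite ltn_eqF // scalerBl scalerA opprB addrC.
(* For [i < n], both [r u] and [w] are already orthogonal to [a i]. For [i = n], [a n] is [w] plus a
   combination of the earlier vectors, so orthogonality to [w] suffices. *)
rewrite ltnS leq_eqVlt => /orP[/eqP->|lin]; last first.
  by rewrite linearBl /= linearZl_LR /= !co // mulr0 subr0.
have ort : '[r u - t u *: w, w] = 0.
  rewrite linearBl /= linearZl_LR /= rw.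
  have [->|w0] := eqVneq w 0; first by rewrite !linear0r subr0.
  by rewrite divfK ?subrr // dnorm_eq0.
have -> : a n = w + \sum_(j < n) c (a n) j *: a j by rewrite subrK.
rewrite linearDr /= ort add0r linear_sumr big1 // => j _.
by rewrite /= dotZr linearBl /= linearZl_LR /= !co // mulr0 subr0 mulr0.
Qed.

End DotProduct.

(** * Distances to spans of kernel functions *)

Section RKHS.
Context {R : realType} {D : Type} {K : D -> D -> R[i]}.
Variable H : rkhs K.
Implicit Types (f u v : H) (x y : D).

Local Notation "''[' u , v ]" := (rk_dot H u v) : ring_scope.
Local Notation k := (rk_kernel H).

Lemma rnormE {V : normedZmodType R[i]} (v : V) : (rnorm v)%:C = `|v|.
Proof. by rewrite RRe_real ?normr_real. Qed.

Lemma rnorm_ge0 {V : normedZmodType R[i]} (v : V) : 0 <= rnorm v.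
Proof. by rewrite -lecR rnormE normr_ge0. Qed.

Lemma Re_le_rnorm (z : R[i]) : complex.Re z <= rnorm z.
Proof. by rewrite (le_trans (ler_norm _)) // -lecR rnormE normc_ge_Re. Qed.

Lemma sqrtC_rk_dot f : sqrtC '[f, f] = `|f|.
Proof. by rewrite -rk_normE sqrCK. Qed.

Lemma rnorm_dot_le u v : rnorm '[u, v] <= rnorm u * rnorm v.
Proof.
by rewrite -lecR rmorphM /= !rnormE -!sqrtC_rk_dot dot_cauchy_schwarz.
Qed.

Lemma rnorm_kernel y : rnorm (k y) = Num.sqrt (complex.Re (K y y)).
Proof.
have -> : K y y = ((rnorm (k y)) ^+ 2)%:C.
  rewrite rmorphXn /= rnormE rk_normE -rk_reproducing.
  by rewrite rk_kernelE.
by rewrite /= sqrtr_sqr ger0_norm ?rnorm_ge0.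
Qed.

Lemma bounded_rnorm_kernel : [set: D] !=set0 -> (kernel_sup K < +oo)%E ->
  exists B : R, forall y, rnorm (k y) <= B.
Proof.
move=> [x0 _] Kfin.
have ub y : ((rnorm (k y))%:E <= kernel_sup K)%E.
  by apply: ereal_sup_ubound; exists y => //; rewrite rnorm_kernel.
(* The point [x0] keeps the supremum above [-oo], so that [fine] returns its true value. *)
exists (fine (kernel_sup K)) => y; rewrite -lee_fin fineK // fin_numElt Kfin andbT.
exact: lt_le_trans (ltNyr _) (ub x0).
Qed.

Lemma lin_span_subset (A B : set H) : A `<=` B -> lin_span A `<=` lin_span B.
Proof. by move=> AB v [n [a [c [aA ->]]]]; exists n, a, c; split=> // i; exact: AB. Qed.

Lemma dist_to_subset (V W : set H) u : V `<=` W -> (dist_to W u <= dist_to V u)%E.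
Proof. by move=> VW; apply: ereal_inf_le_tmp => _ [v Vv <-]; exists v => //; exact: VW. Qed.

(** For [w] in the span, orthogonality gives [|u - v|^2 = <u - v, u - w>]; apply Cauchy-Schwarz and
    divide by [|u - v|]. *)
Lemma dist_to_residual (A : set H) u v : lin_span A v ->
  (forall b, A b -> '[u - v, b] = 0) ->
  dist_to (lin_span A) u = (rnorm (u - v))%:E.
Proof.
move=> Av ort; apply/eqP; rewrite eq_le; apply/andP; split.
  by apply: ereal_inf_lbound; exists v.
apply: le_ereal_inf_tmp => _ [w Aw <-]; rewrite lee_fin.
have ortV z : lin_span A z -> '[u - v, z] = 0.
  move=> [n [a [c [aA ->]]]]; rewrite linear_sumr big1 // => i _.
  by rewrite /= dotZr ort ?mulr0.
have [r0|r_gt0] := leP (rnorm (u - v)) 0; first exact: le_trans (rnorm_ge0 _).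
rewrite -(ler_pM2l r_gt0); apply: le_trans (rnorm_dot_le _ _).
have -> : '[u - v, u - w] = '[u - v, u - v].
  by rewrite !linearBr /= (ortV w) // (ortV v).
rewrite -expr2 -lecR rnormE -rk_normE rmorphXn /= rnormE.
by rewrite ger0_norm ?exprn_ge0.
Qed.

Lemma dist_to_range_kernel (n : nat) (x : nat -> D) (c : nat -> R[i]) u :
  (forall i, (i < n)%N -> '[u - \sum_(j < n) c j *: k (x j), k (x i)] = 0) ->
  dist_to (lin_span [set k z | z in x @` `I_n]) u =
  (rnorm (u - \sum_(j < n) c j *: k (x j)))%:E.
Proof.
move=> ort; apply: dist_to_residual => [|_ [_ [i ilt <-] <-]]; last exact: ort.
exists n, (fun j : 'I_n => k (x j)), (fun j : 'I_n => c j); split=> // i.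
by exists (x i) => //; exists i => //=.
Qed.

(** Replaces a set of at most [n] points by a list of [n] nodes, possibly with repetitions.
    Inclusion is enough, as distances only shrink when the span grows. *)
Lemma card_le_II_image {P : set D} {n} : [set: D] !=set0 -> P #<= `I_n ->
  exists x : nat -> D, P `<=` x @` `I_n.
Proof.
move=> [x0 _] /pfcard_geP[->|[x]]; first by exists (fun=> x0).
by exists x; rewrite image_eq.
Qed.

(* The witness is r / |r|, where r is the residual of the projection of [k y];
   for r = 0 it is the junk value 0, which still works. *)
Lemma fooling_function (n : nat) (x : nat -> D) y :
  exists f, [/\ rnorm f <= 1, forall i, (i < n)%N -> rk_eval H f (x i) = 0 &
    ((complex.Re (rk_eval H f y))%:E =
       dist_to (lin_span [set k z | z in x @` `I_n]) (k y))%E].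
Proof.
have [c [_ [ort _]]] := dot_projection_coef _ _ (rk_dot H) (fun i => k (x i)) n.
set r := k y - \sum_(j < n) c (k y) j *: k (x j).
(* [k y] and [r] differ by a combination of the node kernels, all orthogonal to [r]. *)
have ry : '[r, k y] = `|r| ^+ 2.
  have Ey : k y = r + \sum_(j < n) c (k y) j *: k (x j) by rewrite subrK.
  rewrite rk_normE [in LHS]Ey linearDr /= linear_sumr big1 ?addr0 // => j _.
  by rewrite /= dotZr ort ?mulr0.
exists (`|r|^-1 *: r); split.
- rewrite -lecR rnormE normrZ normfV normr_id.
  by have [->|r0] := eqVneq `|r| 0; rewrite ?mulr0 ?ler01 // mulVf.
- by move=> i ilt; rewrite rk_reproducing linearZl_LR /= ort // mulr0.
- rewrite (dist_to_range_kernel _ _ (c (k y))); last exact: ort.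
  rewrite -/r rk_reproducing linearZl_LR /= ry; congr (_%:E); rewrite /rnorm.
  have [->|r0] := eqVneq `|r| 0; first by rewrite expr0n mulr0.
  by rewrite expr2 mulKf.
Qed.


(** * Comparison of the widths *)

Lemma sup_norm_ubound (g : D -> R[i]^o) y : ((rnorm (g y))%:E <= sup_norm g)%E.
Proof. by apply: ereal_sup_ubound; exists y. Qed.

(** With no nodes the projection is [0] and the residual of [k y] is [k y] itself: Cauchy-Schwarz
    gives one inequality, the fooling function the other. *)
Lemma initial_error_tau_width : [set: D] !=set0 ->
  ereal_sup [set sup_norm (rk_eval H f) | f in @unit_ball _ _ _ H] = tau_width H 0.
Proof.
move=> D0; apply/eqP; rewrite eq_le; apply/andP; split.
  apply: ge_ereal_sup => _ [f f1 <-]; apply: ge_ereal_sup => _ [y _ <-].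
  apply: le_ereal_inf_tmp => _ [P P0 <-].
  have [x Px] := card_le_II_image D0 P0.
  apply: le_trans (ereal_sup_ubound _); last by exists y.
  apply: le_trans (dist_to_subset _ _ _ (lin_span_subset _ _ (image_subset _ Px))).
  rewrite (dist_to_range_kernel _ _ (fun=> 0)) // big_ord0 subr0 lee_fin.
  rewrite rk_reproducing (le_trans (rnorm_dot_le _ _)) //.
  by rewrite ler_piMl ?rnorm_ge0.
have [x0 _] := D0.
apply: (@le_trans _ _ (ereal_sup [set dist_to (lin_span
    [set k z | z in (fun=> x0) @` `I_0]) (k y) | y in [set: D]])).
  by apply: ereal_inf_lbound; exists ((fun=> x0) @` `I_0) => //; exact: card_image_le.
apply: ge_ereal_sup => _ [y _ <-].
have [f [f1 _ <-]] := fooling_function 0 (fun=> x0) y.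
apply: (@le_trans _ _ (sup_norm (rk_eval H f))).
  by apply: le_trans (sup_norm_ubound _ y); rewrite lee_fin Re_le_rnorm.
by apply: ereal_sup_ubound; exists f.
Qed.

Lemma linear_sampling_width_le_tau_width (m : nat) :
  [set: D] !=set0 -> (kernel_sup K < +oo)%E ->
  (linear_sampling_width H m.+1 <= tau_width H m.+1)%E.
Proof.
move=> D0 Kfin; have [B leB] := bounded_rnorm_kernel D0 Kfin.
apply: le_ereal_inf_tmp => _ [P Pm <-].
have [x Px] := card_le_II_image D0 Pm.
have [c [M [ort [M_ge0 cM]]]] := dot_projection_coef _ _ (rk_dot H) (fun i => k (x i)) m.+1.
(* The conjugate appears because the form is conjugate-linear in its second argument. *)
pose phi (a : 'rV[R[i]]_m.+1) : D -> R[i]^o :=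
  fun y => \sum_(j < m.+1) a 0 j * conjC (c (k y) j).
apply: (@le_trans _ _ (recovery_error H (fun i : 'I_m.+1 => x i) phi)).
  apply: ereal_inf_lbound; exists (fun i : 'I_m.+1 => x i, phi) => //=; split.
    (* Each [phi a] is bounded on [D] because [|c (k y) j| <= M j * |k y| <= M j * B], uniformly in
       [y]. *)
    move=> a; exists (\sum_(j < m.+1) `|a 0 j| * (M j * B%:C)); split.
      rewrite ger0_real // sumr_ge0 // => j _; rewrite !mulr_ge0 // lecR.
      by have [y0 _] := D0; exact: le_trans (rnorm_ge0 _) (leB y0).
    move=> N /ltW leN y _ /=; apply: le_trans leN.
    apply: le_trans (ler_norm_sum _ _ _) _; apply: ler_sum => j _.
    rewrite normrM norm_conjC ler_wpM2l // (le_trans (cM _ _)) //.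
    rewrite sqrtC_rk_dot -rnormE.
    by rewrite ler_wpM2l // lecR.
  move=> s a b; apply/funext => y.
  transitivity (s * phi a y + phi b y); last by [].
  rewrite /phi mulr_sumr -big_split /=; apply: eq_bigr => j _.
  by rewrite !mxE mulrDl mulrA.
apply: ge_ereal_sup => _ [f f1 <-]; apply: ge_ereal_sup => _ [y _ <-].
apply: (@le_trans _ _ (dist_to (lin_span [set k z | z in P]) (k y))); last first.
  by apply: ereal_sup_ubound; exists y.
apply: (@le_trans _ _ (dist_to (lin_span [set k z | z in x @` `I_m.+1]) (k y))); last first.
  apply: dist_to_subset; apply: lin_span_subset; exact: image_subset.
rewrite (dist_to_range_kernel _ _ (c (k y))); last by move=> i; apply: ort.
rewrite lee_fin.
set r := k y - _.
have -> : (rk_eval H f - phi (\row_i rk_eval H f (x i))) y = '[f, r].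
  transitivity (rk_eval H f y - phi (\row_i rk_eval H f (x i)) y); first by [].
  rewrite linearBr /= linear_sumr rk_reproducing; congr (_ - _).
  by apply: eq_bigr => j _; rewrite /= dotZr mxE rk_reproducing mulrC.
apply: le_trans (rnorm_dot_le _ _) _.
by rewrite ler_piMl ?rnorm_ge0.
Qed.

Lemma tau_width_le_sampling_width (m : nat) :
  (tau_width H m.+1 <= sampling_width H m.+1)%E.
Proof.
apply: le_ereal_inf_tmp => _ [[x phi] /= _ <-].
(* Extends the nodes to all of [nat]; [x'] agrees with [x] on indices up to [m]. *)
pose x' j := x (inord j).
apply: (@le_trans _ _ (ereal_sup [set dist_to (lin_span [set k z | z in x' @` `I_m.+1])
          (k y) | y in [set: D]])).
  by apply: ereal_inf_lbound; exists (x' @` `I_m.+1) => //; exact: card_image_le.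
apply: ge_ereal_sup => _ [y _ <-].
have [f [f1 fx <-]] := fooling_function m.+1 x' y.
have fx0 i : rk_eval H f (x i) = 0 by rewrite -(fx i) // /x' inord_val.
have node : \row_i rk_eval H f (x i) = 0 by apply/rowP => i; rewrite !mxE fx0.
have nodeN : \row_i rk_eval H (- f) (x i) = 0.
  apply/rowP => i; rewrite !mxE raddfN.
  transitivity (- rk_eval H f (x i)); first by [].
  by rewrite fx0 oppr0.
have err g : rnorm g <= 1 -> \row_i rk_eval H g (x i) = 0 ->
    ((rnorm (rk_eval H g y - phi 0 y))%:E <= recovery_error H x phi)%E.
  move=> g1 g0; apply: (@le_trans _ _ (sup_norm (rk_eval H g - phi 0))).
    exact: (sup_norm_ubound (rk_eval H g - phi 0)).
  by apply: ereal_sup_ubound; exists g => //; rewrite g0.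
have f1' : rnorm (- f) <= 1 by rewrite /rnorm normrN.
have := err _ f1 node; have := err _ f1' nodeN.
rewrite raddfN /=; set b := phi 0 y; set z := rk_eval H f y.
(* [Re z] is the distance to be bounded. If [|z - b| < Re z], then [Re b > 0], so the error for
   [- f] satisfies [|- z - b| >= Re (z + b) > Re z]. *)
have [le1|lt1] := leP (complex.Re z) (rnorm (z - b)).
  by move=> _; apply: le_trans; rewrite lee_fin.
move=> + _; apply: le_trans; rewrite lee_fin.
have Nw : rnorm (- (- z - b)) = rnorm (- z - b) by rewrite /rnorm normrN.
have := Re_le_rnorm (- (- z - b)); have := Re_le_rnorm (z - b).
rewrite Nw opprD !opprK !raddfD raddfN /=; lra.
Qed.

End RKHS.

Theorem proposition3p2 (R : realType) (D : Type) (K : D -> D -> R[i])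
    (H : rkhs K) (D_nonempty : [set: D] !=set0)
    (K_bounded : (kernel_sup K < +oo)%E) (m : nat) :
  sampling_width H m = linear_sampling_width H m /\
  linear_sampling_width H m = tau_width H m.
Proof.
(* For [m = 0] both widths unfold to the same initial error. *)
case: m => [|m]; first by split=> //; exact: initial_error_tau_width.
have lin_tau := linear_sampling_width_le_tau_width H m D_nonempty K_bounded.
have tau_nonlin := tau_width_le_sampling_width H m.
have nonlin_lin : (sampling_width H m.+1 <= linear_sampling_width H m.+1)%E.
  by apply: ereal_inf_le_tmp => _ [p [pB _] <-]; exists p.
split; apply/eqP; rewrite eq_le ?nonlin_lin ?lin_tau /=.
  exact: le_trans lin_tau tau_nonlin.
exact: le_trans tau_nonlin nonlin_lin.
Qed.
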